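(* Let $R$ be a basic formal matrix ring of order $n$ with a Nakayama permutation $\pi$, with local rings $R_1,\dots,R_n$ on the diagonal and coordinate bimodules $B_{i,j}$. The right socle of $R$ is essential as a right ideal if and only if for each $i\le n$: (a) the simple right $R_{\pi(i)}$-module $T_{\pi(i)}$ is an essential right $R_{\pi(i)}$-submodule of $B_{i,\pi(i)}$; and (b) for all $j\neq\pi(i)$ and all nonzero $m\in B_{i,j}$, one has $mB_{j,\pi(i)}\neq 0$. The left socle of $R$ is essential as a left ideal if and only if for each $i\le n$: (a') the simple left $R_i$-module $T'_i$ is an essential left $R_i$-submodule of $B_{i,\pi(i)}$; and (b') for all $j\neq i$ and all nonzero $m\in B_{j,\pi(i)}$, one has $B_{i,j}m\neq 0$.
   Context: Rings are associative and unital; $S_n$ is the symmetric group on $\{1,\dots,n\}$; $J(R)$ is the Jacobson radical. Formal matrix ring of order $n$: given local rings $R_1,\dots,R_n$, $R_i$-$R_j$-bimodules $B_{i,j}$ (coordinate bimodules) with $B_{i,i}=R_i$, and $R_i$-$R_k$-bimodule homomorphisms (product homomorphisms) $\varphi_{i,j,k}\colon B_{i,j}\otimes_{R_j}B_{j,k}\to B_{i,k}$, written $ab:=\varphi_{i,j,k}(a\otimes b)$, where $\varphi_{i,i,j}$ and $\varphi_{i,j,j}$ are the bimodule actions and $(ab)c=a(bc)$ for all $a\in B_{i,j}$, $b\in B_{j,k}$, $c\in B_{k,l}$. The ring $R$ is the set of $n\times n$ matrices whose $(i,j)$ entry lies in $B_{i,j}$, with the usual matrix addition and multiplication. The canonical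 idempotent $e_i$ is the matrix with $1_{R_i}$ at position $(i,i)$ and zeros elsewhere. For $m\in B_{i,j}$, $mB_{j,k}=\{mb: b\in B_{j,k}\}$ and $B_{h,i}m=\{bm : b\in B_{h,i}\}$. $R$ is basic if the right modules $e_1R,\dots,e_nR$ are pairwise non-isomorphic. Nakayama permutation: a basic formal matrix ring $R$ of order $n$ is a ring with a Nakayama permutation $\pi\in S_n$ if for each $i\le n$ one has $soc(e_iR)\cong top(e_{\pi(i)}R)$ as right $R$-modules and $soc(Re_{\pi(i)})\cong top(Re_i)$ as left $R$-modules, where $top(M)=M/MJ(R)$ (resp. $M/J(R)M$). Notation: $T_{\pi(i)}$ is the socle, as a right $R_{\pi(i)}$-module, of the subbimodule $\{m\in B_{i,\pi(i)} : mB_{\pi(i),j}=0 \text{ for all } j\neq\pi(i)\}$ of $B_{i,\pi(i)}$; $T'_i$ is the socle, as a left $R_i$-module, of the subbimodule $\{m\in B_{i,\pi(i)} : B_{h,i}m=0\text{ for all }h\neq i\}$. Since $\pi$ is a Nakayama permutation of $R$, these are simple as a right $R_{\pi(i)}$-module and a left $R_i$-module, respectively. *)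

(* Defs.v *)
From HB Require Import structures.
From mathcomp Require Import all_boot all_algebra perm.
From mathcomp Require Import boolp.

Set Implicit Arguments.
Unset Strict Implicit.
Unset Printing Implicit Defensive.

Import GRing.Theory.
Local Open Scope ring_scope.
Local Open Scope quotient_scope.

(* Modules are left modules over a possibly noncommutative ring S.  Right
   S-modules are the objects of lmodType S^c, with a *: m standing for m a; in
   particular S^o and S^c^o are S as a left and as a right module over itself,
   so submodules of S^o (resp. S^c^o) are left (resp. right) ideals.  A
   submodule is an element of submodClosed M; its membership predicate is
   boolean, but by classical logic (`[< _ >]) this is no restriction. *)

Section Modules.
Variables (S : pzRingType) (M : lmodType S).
Implicit Types (N L P : submodClosed M) (F : submodClosed M -> Prop).

Definition zero_submod N : Prop := forall x, x \in N -> x = 0.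

Definition simple_submod P : Prop :=
  ~ zero_submod P /\
  forall L, {subset L <= P} -> zero_submod L \/ {subset P <= L}.

Definition essential N : Prop :=
  forall L, ~ zero_submod L -> exists x : M, [/\ x \in L, x \in N & x != 0].

Definition maximal_submod N : Prop :=
  (exists x : M, x \notin N) /\
  forall L, {subset N <= L} -> {subset L <= N} \/ (forall x : M, x \in L).

Definition submod_sum F : {pred M} :=
  fun x => `[< forall L, (forall P, F P -> {subset P <= L}) -> x \in L >].

Fact submod_sum_closed F : submod_closed (submod_sum F).
Proof.
split=> [|a x y /asboolP xF /asboolP yF]; apply/asboolP => L FL.
  exact: rpred0.
by rewrite rpredD ?rpredZ ?xF ?yF.
Qed.
HB.instance Definition _ F :=
  GRing.isSubmodClosed.Build S M (submod_sum F) (submod_sum_closed F).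

Definition socle N : submodClosed M :=
  submod_sum (fun P => simple_submod P /\ {subset P <= N}).

Definition cyclic_submod (m : M) : {pred M} :=
  fun x => `[< exists a : S, x = a *: m >].

Fact cyclic_submod_closed m : submod_closed (cyclic_submod m).
Proof.
split=> [|a x y /asboolP[b ->] /asboolP[c ->]]; apply/asboolP.
  by exists 0; rewrite scale0r.
by exists (a * b + c); rewrite scalerDl scalerA.
Qed.
HB.instance Definition _ m :=
  GRing.isSubmodClosed.Build S M (cyclic_submod m) (cyclic_submod_closed m).

Definition full_submod : {pred M} := predT.

Fact full_submod_closed : submod_closed full_submod.
Proof. by []. Qed.
HB.instance Definition _ :=
  GRing.isSubmodClosed.Build S M full_submod full_submod_closed.

(* J M, the submodule generated by the products a *: m with a in J. *)
Definition ideal_smul (J : {pred S}) : {pred M} :=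
  fun x => `[< forall L,
    (forall a m, a \in J -> a *: m \in L) -> x \in L >].

Fact ideal_smul_closed J : submod_closed (ideal_smul J).
Proof.
split=> [|a x y /asboolP xF /asboolP yF]; apply/asboolP => L FL.
  exact: rpred0.
by rewrite rpredD ?rpredZ ?xF ?yF.
Qed.
HB.instance Definition _ J :=
  GRing.isSubmodClosed.Build S M (ideal_smul J) (ideal_smul_closed J).

Record sub_lmod N := SubLmod { sub_val : M; sub_valP : sub_val \in N }.
HB.instance Definition _ N := [isSub for @sub_val N].
HB.instance Definition _ N := [Choice of sub_lmod N by <:].
HB.instance Definition _ N := [SubChoice_isSubLmodule of sub_lmod N by <:].

(* submodClosed does not inherit from zmodClosed in the hierarchy *)
Definition submod_zmod N : {pred M} := fun x => x \in N.
Fact submod_zmod_closed N : zmod_closed (submod_zmod N).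
Proof. exact: GRing.submod_closedB (submodClosedP N). Qed.
HB.instance Definition _ N :=
  GRing.isZmodClosed.Build M (submod_zmod N) (submod_zmod_closed N).

Definition quot_lmod N : Type := Quotient.quot (submod_zmod N).
HB.instance Definition _ N := GRing.Zmodule.on (quot_lmod N).
HB.instance Definition _ N :=
  EqQuotient.copy (quot_lmod N) (Quotient.quot (submod_zmod N)).

Definition quot_scale N (a : S) (u : quot_lmod N) : quot_lmod N :=
  \pi_(quot_lmod N) (a *: repr u).

Fact pi_quot_scale N a (x : M) :
  \pi_(quot_lmod N) (a *: x) = quot_scale a (\pi_(quot_lmod N) x).
Proof.
apply/eqP; rewrite -Quotient.idealrBE -scalerBr [_ \in _]rpredZ //.
by rewrite -[_ \in N]/(_ \in submod_zmod N) Quotient.idealrBE reprK.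
Qed.

Fact pi_quot_add N (x y : M) : \pi_(quot_lmod N) (x + y) =
  \pi_(quot_lmod N) x + \pi_(quot_lmod N) y :> quot_lmod N.
Proof. exact: (@Quotient.pi_add _ (submod_zmod N)). Qed.

Fact quot_scaleA N a b (u : quot_lmod N) :
  quot_scale a (quot_scale b u) = quot_scale (a * b) u.
Proof.
rewrite -[u]reprK; move: (repr u) => x.
by rewrite -(pi_quot_scale N b x) -(pi_quot_scale N a) -pi_quot_scale scalerA.
Qed.

Fact quot_scale1 N : left_id 1 (@quot_scale N).
Proof.
move=> u; rewrite -[u]reprK; move: (repr u) => x.
by rewrite -(pi_quot_scale N 1 x) scale1r.
Qed.

Fact quot_scaleDr N : right_distributive (@quot_scale N) +%R.
Proof.
move=> a u v; rewrite -[u]reprK -[v]reprK.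
move: (repr u) (repr v) => x y; rewrite -(pi_quot_add N x y).
by rewrite -!(pi_quot_scale N a) -pi_quot_add scalerDr.
Qed.

Fact quot_scaleDl N u : {morph (@quot_scale N)^~ u : a b / a + b}.
Proof.
move=> a b /=; rewrite -[u]reprK; move: (repr u) => x.
rewrite -(pi_quot_scale N (a + b) x) -(pi_quot_scale N a x).
by rewrite -(pi_quot_scale N b x) -pi_quot_add scalerDl.
Qed.

HB.instance Definition _ N :=
  GRing.Zmodule_isLmodule.Build S (quot_lmod N)
    (@quot_scaleA N) (@quot_scale1 N) (@quot_scaleDr N) (@quot_scaleDl N).

End Modules.

Definition lmod_iso (S : pzRingType) (M M' : lmodType S) : Prop :=
  exists f : {linear M -> M'}, bijective f.

Definition jacobson (R : pzRingType) : {pred R} :=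
  fun x => `[< forall L : submodClosed R^o, maximal_submod L -> x \in L >].

Arguments jacobson R : clear implicits.

Definition is_unit (R : pzRingType) (x : R) : Prop :=
  exists y, x * y = 1 /\ y * x = 1.

Definition local_ring (R : pzRingType) : Prop :=
  (1 : R) <> 0 /\
  forall x y : R, ~ is_unit x -> ~ is_unit y -> ~ is_unit (x + y).

(* The data (R_i, B_{i,j}, phi_{i,j,k}) of a formal matrix ring, where R_i is
   B_{i,i}.  Since phi_{i,i,j} and phi_{i,j,j} are the bimodule actions, the
   ring axioms of the R_i, the bimodule axioms of the B_{i,j}, the
   R_j-balancedness of fm_mul (that is, its factorization through the tensor
   product over R_j) and the bilinearity over R_i and R_k of the resulting map
   are all instances of biadditivity, unitality and associativity. *)
Record fmdata (n : nat) := FMData {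
  coord :> 'I_n -> 'I_n -> zmodType;
  fm_one : forall i, coord i i;
  fm_mul : forall i j k, coord i j -> coord j k -> coord i k;
  fm_mulDl : forall i j k (a a' : coord i j) (b : coord j k),
    fm_mul (a + a') b = fm_mul a b + fm_mul a' b;
  fm_mulDr : forall i j k (a : coord i j) (b b' : coord j k),
    fm_mul a (b + b') = fm_mul a b + fm_mul a b';
  fm_mul1l : forall i j (a : coord i j), fm_mul (fm_one i) a = a;
  fm_mul1r : forall i j (a : coord i j), fm_mul a (fm_one j) = a;
  fm_mulA : forall i j k l (a : coord i j) (b : coord j k) (c : coord k l),
    fm_mul (fm_mul a b) c = fm_mul a (fm_mul b c)
}.

Section FormalMatrices.
Variables (n : nat) (A : fmdata n).
Implicit Types (i j k l : 'I_n).

Fact fm_mul0l i j k (b : A j k) : fm_mul (0 : A i j) b = 0.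
Proof. by apply: (addrI (fm_mul (0 : A i j) b)); rewrite -fm_mulDl !addr0. Qed.

Fact fm_mul0r i j k (a : A i j) : fm_mul a (0 : A j k) = 0.
Proof. by apply: (addrI (fm_mul a (0 : A j k))); rewrite -fm_mulDr !addr0. Qed.

Fact fm_mul_suml i j k (I : finType) (F : I -> A i j) (b : A j k) :
  fm_mul (\sum_x F x) b = \sum_x fm_mul (F x) b.
Proof.
apply: (big_morph (fun a => fm_mul a b)) => [a a'|].
  exact: fm_mulDl.
exact: fm_mul0l.
Qed.

Fact fm_mul_sumr i j k (I : finType) (a : A i j) (F : I -> A j k) :
  fm_mul a (\sum_x F x) = \sum_x fm_mul a (F x).
Proof.
apply: (big_morph (fun b => fm_mul a b)) => [b b'|].
  exact: fm_mulDr.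
exact: fm_mul0r.
Qed.

Definition diag_ring i : Type := A i i.
HB.instance Definition _ i := GRing.Zmodule.on (diag_ring i).

Fact diag_mulA i : associative (fun a b : diag_ring i => fm_mul a b).
Proof. by move=> a b c; rewrite fm_mulA. Qed.
Fact diag_mul1l i :
  left_id (fm_one A i) (fun a b : diag_ring i => fm_mul a b).
Proof. by move=> a; rewrite fm_mul1l. Qed.
Fact diag_mul1r i :
  right_id (fm_one A i) (fun a b : diag_ring i => fm_mul a b).
Proof. by move=> a; rewrite fm_mul1r. Qed.
Fact diag_mulDl i :
  left_distributive (fun a b : diag_ring i => fm_mul a b) +%R.
Proof. by move=> a b c; rewrite fm_mulDl. Qed.
Fact diag_mulDr i :
  right_distributive (fun a b : diag_ring i => fm_mul a b) +%R.
Proof. by move=> a b c; rewrite fm_mulDr. Qed.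
HB.instance Definition _ i := GRing.Zmodule_isPzRing.Build (diag_ring i)
  (@diag_mulA i) (@diag_mul1l i) (@diag_mul1r i) (@diag_mulDl i)
  (@diag_mulDr i).

(* B_{i,j} as a left R_i-module *)
Definition lcoord i j : Type := A i j.
HB.instance Definition _ i j := GRing.Zmodule.on (lcoord i j).

Definition lcoord_scale i j (a : diag_ring i) (m : lcoord i j) : lcoord i j :=
  fm_mul a m.
Fact lcoord_scaleA i j (a b : diag_ring i) (m : lcoord i j) :
  lcoord_scale a (lcoord_scale b m) = lcoord_scale (a * b) m.
Proof. by rewrite /lcoord_scale -fm_mulA. Qed.
Fact lcoord_scale1 i j : left_id 1 (@lcoord_scale i j).
Proof. by move=> m; rewrite /lcoord_scale fm_mul1l. Qed.
Fact lcoord_scaleDr i j : right_distributive (@lcoord_scale i j) +%R.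
Proof. by move=> a m m'; rewrite /lcoord_scale fm_mulDr. Qed.
Fact lcoord_scaleDl i j m : {morph (@lcoord_scale i j)^~ m : a b / a + b}.
Proof. by move=> a b; rewrite /lcoord_scale fm_mulDl. Qed.
HB.instance Definition _ i j :=
  GRing.Zmodule_isLmodule.Build (diag_ring i) (lcoord i j)
    (@lcoord_scaleA i j) (@lcoord_scale1 i j) (@lcoord_scaleDr i j)
    (@lcoord_scaleDl i j).

(* B_{i,j} as a right R_j-module *)
Definition rcoord i j : Type := A i j.
HB.instance Definition _ i j := GRing.Zmodule.on (rcoord i j).

Definition rcoord_scale i j (a : (diag_ring j)^c) (m : rcoord i j) :
  rcoord i j := fm_mul m (a : diag_ring j).
Fact rcoord_scaleA i j (a b : (diag_ring j)^c) (m : rcoord i j) :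
  rcoord_scale a (rcoord_scale b m) = rcoord_scale (a * b) m.
Proof. by rewrite /rcoord_scale fm_mulA. Qed.
Fact rcoord_scale1 i j : left_id 1 (@rcoord_scale i j).
Proof. by move=> m; rewrite /rcoord_scale fm_mul1r. Qed.
Fact rcoord_scaleDr i j : right_distributive (@rcoord_scale i j) +%R.
Proof. by move=> a m m'; rewrite /rcoord_scale fm_mulDl. Qed.
Fact rcoord_scaleDl i j m : {morph (@rcoord_scale i j)^~ m : a b / a + b}.
Proof. by move=> a b; rewrite /rcoord_scale fm_mulDr. Qed.
HB.instance Definition _ i j :=
  GRing.Zmodule_isLmodule.Build (diag_ring j)^c (rcoord i j)
    (@rcoord_scaleA i j) (@rcoord_scale1 i j) (@rcoord_scaleDr i j)
    (@rcoord_scaleDl i j).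

Definition fmring : Type := {dffun forall p : 'I_n * 'I_n, A p.1 p.2}.
HB.instance Definition _ := Choice.on fmring.

Definition fm_entry (x : fmring) i j : A i j := x (i, j).

Definition fm_mk (F : forall i j, A i j) : fmring :=
  [ffun p : 'I_n * 'I_n => F p.1 p.2].

Fact fm_mkE F i j : fm_entry (fm_mk F) i j = F i j.
Proof. by rewrite /fm_entry ffunE. Qed.

Fact fm_eqP (x y : fmring) :
  (forall i j, fm_entry x i j = fm_entry y i j) <-> x = y.
Proof. by split=> [xy|->//]; apply/ffunP => -[i j]; exact: xy. Qed.

Definition fmring_add (x y : fmring) :=
  fm_mk (fun i j => fm_entry x i j + fm_entry y i j).
Definition fmring_opp (x : fmring) := fm_mk (fun i j => - fm_entry x i j).
Definition fmring_zero := fm_mk (fun i j => 0).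

Fact fmring_addA : associative fmring_add.
Proof. by move=> x y z; apply/fm_eqP => i j; rewrite !fm_mkE addrA. Qed.
Fact fmring_addC : commutative fmring_add.
Proof. by move=> x y; apply/fm_eqP => i j; rewrite !fm_mkE addrC. Qed.
Fact fmring_add0 : left_id fmring_zero fmring_add.
Proof. by move=> x; apply/fm_eqP => i j; rewrite !fm_mkE add0r. Qed.
Fact fmring_addN : left_inverse fmring_zero fmring_opp fmring_add.
Proof. by move=> x; apply/fm_eqP => i j; rewrite !fm_mkE addNr. Qed.
HB.instance Definition _ :=
  GRing.isZmodule.Build fmring fmring_addA fmring_addC fmring_add0 fmring_addN.

Definition fm_delta i j : A i j :=
  match i =P j with
  | ReflectT e => eq_rect i (A i) (fm_one A i) j e
  | ReflectF _ => 0
  end.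

Fact fm_deltaii i : fm_delta i i = fm_one A i.
Proof.
rewrite /fm_delta; case: eqP => // e.
by rewrite (eq_axiomK e).
Qed.

Fact fm_delta_neq i j : i != j -> fm_delta i j = 0.
Proof. by rewrite /fm_delta; case: eqP. Qed.

Definition fmring_one := fm_mk fm_delta.
Definition fmring_mul (x y : fmring) :=
  fm_mk (fun i k => \sum_j fm_mul (fm_entry x i j) (fm_entry y j k)).

Fact fmring_mulA : associative fmring_mul.
Proof.
move=> x y z; apply/fm_eqP => i l; rewrite !fm_mkE.
under eq_bigr do rewrite fm_mkE fm_mul_sumr.
under [RHS]eq_bigr do rewrite fm_mkE fm_mul_suml.
rewrite exchange_big; apply: eq_bigr => j _; apply: eq_bigr => k _.
by rewrite fm_mulA.
Qed.

Fact fmring_mul1l : left_id fmring_one fmring_mul.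
Proof.
move=> x; apply/fm_eqP => i k; rewrite fm_mkE (bigD1 i) //= big1 => [|j ji].
  by rewrite fm_mkE fm_deltaii fm_mul1l addr0.
by rewrite fm_mkE fm_delta_neq 1?eq_sym // fm_mul0l.
Qed.

Fact fmring_mul1r : right_id fmring_one fmring_mul.
Proof.
move=> x; apply/fm_eqP => i k; rewrite fm_mkE (bigD1 k) //= big1 => [|j ji].
  by rewrite fm_mkE fm_deltaii fm_mul1r addr0.
by rewrite fm_mkE fm_delta_neq // fm_mul0r.
Qed.

Fact fmring_mulDl : left_distributive fmring_mul +%R.
Proof.
move=> x y z; apply/fm_eqP => i k; rewrite !fm_mkE -big_split /=.
by apply: eq_bigr => j _; rewrite fm_mkE fm_mulDl.
Qed.

Fact fmring_mulDr : right_distributive fmring_mul +%R.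
Proof.
move=> x y z; apply/fm_eqP => i k; rewrite !fm_mkE -big_split /=.
by apply: eq_bigr => j _; rewrite fm_mkE fm_mulDr.
Qed.

HB.instance Definition _ := GRing.Zmodule_isPzRing.Build fmring
  fmring_mulA fmring_mul1l fmring_mul1r fmring_mulDl fmring_mulDr.

Definition fm_idem i : fmring :=
  fm_mk (fun k l => if k == i then fm_delta k l else 0).

(* e_i R as a right ideal, and R e_i as a left ideal *)
Definition eR i : submodClosed fmring^c^o :=
  cyclic_submod (fm_idem i : fmring^c^o).
Definition Re i : submodClosed fmring^o :=
  cyclic_submod (fm_idem i : fmring^o).

Definition fm_basic : Prop :=
  forall i j, i != j -> ~ lmod_iso (sub_lmod (eR i)) (sub_lmod (eR j)).

(* top(M) = M / M J(R) for right modules M, M / J(R) M for left modules M *)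
Definition rtop (M : lmodType fmring^c) : lmodType fmring^c :=
  quot_lmod (ideal_smul (M := M) (jacobson fmring : {pred fmring^c})).
Definition ltop (M : lmodType fmring) : lmodType fmring :=
  quot_lmod (ideal_smul (M := M) (jacobson fmring)).

Definition nakayama_perm (s : 'S_n) : Prop :=
  forall i,
    lmod_iso (sub_lmod (socle (eR i))) (rtop (sub_lmod (eR (s i)))) /\
    lmod_iso (sub_lmod (socle (Re (s i)))) (ltop (sub_lmod (Re i))).

Definition rsocle : submodClosed fmring^c^o :=
  socle (@full_submod _ fmring^c^o).
Definition lsocle : submodClosed fmring^o := socle (@full_submod _ fmring^o).

(* mulB m k is the subset m B_{j,k} of B_{i,k}, for m in B_{i,j};
   Bmul h m is the subset B_{h,i} m of B_{h,j}. *)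
Definition mulB i j (m : A i j) k (x : A i k) : Prop :=
  exists b : A j k, x = fm_mul m b.
Definition Bmul h i j (m : A i j) (x : A h j) : Prop :=
  exists b : A h i, x = fm_mul b m.

Definition zero_set (V : zmodType) (X : V -> Prop) : Prop :=
  forall x, X x <-> x = 0.

Definition rann_off i j : {pred rcoord i j} :=
  fun m => `[< forall k, k != j -> zero_set (@mulB i j m k) >].
Definition lann_off i j : {pred lcoord i j} :=
  fun m => `[< forall h, h != i -> zero_set (@Bmul h i j m) >].

Fact zero_mulB i j (m : A i j) k :
  zero_set (@mulB i j m k) <-> forall b : A j k, fm_mul m b = 0.
Proof.
split=> [m0 b|m0 x]; first by apply/m0; exists b.
by split=> [[b ->]|->] //; exists 0; rewrite fm_mul0r.
Qed.

Fact zero_Bmul h i j (m : A i j) :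
  zero_set (@Bmul h i j m) <-> forall b : A h i, fm_mul b m = 0.
Proof.
split=> [m0 b|m0 x]; first by apply/m0; exists b.
by split=> [[b ->]|->] //; exists 0; rewrite fm_mul0l.
Qed.

Fact rann_off_closed i j : submod_closed (@rann_off i j).
Proof.
split=> [|a x y /asboolP x0 /asboolP y0]; apply/asboolP => k kj.
  by apply/zero_mulB => b; exact: fm_mul0l.
move/zero_mulB: (x0 k kj) => {}x0; move/zero_mulB: (y0 k kj) => {}y0.
apply/zero_mulB => b; rewrite fm_mulDl y0 addr0.
by rewrite [LHS]fm_mulA x0.
Qed.
HB.instance Definition _ i j := GRing.isSubmodClosed.Build
  (diag_ring j)^c (rcoord i j) (@rann_off i j) (@rann_off_closed i j).

Fact lann_off_closed i j : submod_closed (@lann_off i j).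
Proof.
split=> [|a x y /asboolP x0 /asboolP y0]; apply/asboolP => h hi.
  by apply/zero_Bmul => b; exact: fm_mul0r.
move/zero_Bmul: (x0 h hi) => {}x0; move/zero_Bmul: (y0 h hi) => {}y0.
apply/zero_Bmul => b; rewrite fm_mulDr y0 addr0.
by rewrite -[LHS]fm_mulA x0.
Qed.
HB.instance Definition _ i j := GRing.isSubmodClosed.Build
  (diag_ring i) (lcoord i j) (@lann_off i j) (@lann_off_closed i j).

(* T_{s(i)} and T'_i, as submodules of B_{i,s(i)} *)
Definition Tr (s : 'S_n) i : submodClosed (rcoord i (s i)) :=
  socle (@rann_off i (s i)).
Definition Tl (s : 'S_n) i : submodClosed (lcoord i (s i)) :=
  socle (@lann_off i (s i)).

End FormalMatrices.

(* Main.v *)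
Require Import Defs.
From HB Require Import structures.
From mathcomp Require Import all_boot all_algebra perm.
From mathcomp Require Import boolp.

(** Write S for the formal matrix ring or for its opposite, so that both halves
    of the theorem are about left ideals of S, and let e_1, ..., e_n be the
    canonical idempotents.  Three ideas carry the proof.

    Every essentiality question localizes at the idempotents: as the e_i sum
    to 1, a left ideal N is essential as soon as every nonzero y in some S e_i
    has a nonzero multiple in N ([essential_summands]).

    Fix a summand S f, with f = e_i, and a second canonical idempotent e.  The
    corner e S f is a coordinate bimodule, seen as a left module over the
    diagonal ring e S e.  Call a corner element off-annihilated if it is killed
    by the other rows, that is, if its S-multiples stay in the corner.  On such
    elements the S-orbit and the (e S e)-orbit coincide, so that simple
    submodules, hence socles, correspond on both sides ([socle_transfer],
    [embed_socle], [proj_socle]).  If moreover e acts as the identity on the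
    socle of S f, then that socle consists of off-annihilated corner elements,
    and essentiality of the socle in S f splits into two conditions: every
    nonzero element of S f has a nonzero multiple in the corner, which is (b)
    or (b'), and the corner socle is essential in the corner, which is (a) or
    (a').  This is [corner_essential].

    It remains to see that e acts as the identity on the socle of S f when the
    permutation pairs f with e.  By definition of a Nakayama permutation this
    socle is isomorphic to top(S e), so it suffices that e_j S e lies in the
    Jacobson radical whenever e_j differs from e ([iso_top_fixed]).  For a in
    B_{k,j} and b in B_{j,k} with j <> k, the product b a is not a unit of R_j:
    otherwise a (b a)^-1 b would be a nonzero idempotent of the local ring R_k,
    hence 1, and e_j R would be isomorphic to e_k R ([offdiag_nonunit]).
    Locality of R_j then makes 1 - b a a unit, which places a in every maximal
    left ideal ([offdiag_jacobson]). *)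

Set Implicit Arguments.
Unset Strict Implicit.
Unset Printing Implicit Defensive.

Import GRing.Theory.
Local Open Scope ring_scope.

(** * Submodules and socles *)

Section Submodules.
Variables (S : pzRingType) (M : lmodType S).
Implicit Types (N P : submodClosed M).

Definition submod_of (Q : M -> Prop)
    (Qcl : submod_closed (fun x => `[< Q x >])) : submodClosed M :=
  HB.pack (fun x => `[< Q x >] : bool)
    (GRing.isSubmodClosed.Build S M (fun x => `[< Q x >]) Qcl).

Lemma submod_ofP Q (Qcl : submod_closed (fun x => `[< Q x >])) x :
  reflect (Q x) (x \in submod_of Qcl).
Proof. exact: asboolP. Qed.

Lemma not_zero_submod N :
  ~ zero_submod N -> exists x, x \in N /\ x != 0.
Proof.
move=> nzN; apply: contrapT => noN; apply: nzN => x xN.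
by apply: contrapT => /eqP nzx; apply: noN; exists x.
Qed.

Lemma nonzero_submod N x : x \in N -> x != 0 -> ~ zero_submod N.
Proof. by move=> xN /eqP nzx zN; exact: nzx (zN x xN). Qed.

Lemma mem_cyclic_submod (m : M) a : a *: m \in cyclic_submod m.
Proof. by apply/asboolP; exists a. Qed.

Lemma cyclic_gen (m : M) : m \in cyclic_submod m.
Proof. by apply/asboolP; exists 1; rewrite scale1r. Qed.

Lemma socleP N x :
  reflect (forall L : submodClosed M,
      (forall P, simple_submod P /\ {subset P <= N} -> {subset P <= L}) ->
    x \in L) (x \in socle N).
Proof. exact: asboolP. Qed.

Lemma mem_socle N P x :
  simple_submod P -> {subset P <= N} -> x \in P -> x \in socle N.
Proof. by move=> sP PN xP; apply/socleP => L /(_ P (conj sP PN)); apply. Qed.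

Lemma socle_min N (L : submodClosed M) :
  (forall P, simple_submod P -> {subset P <= N} -> {subset P <= L}) ->
  {subset socle N <= L}.
Proof. by move=> NL x /socleP; apply=> P []; exact: NL. Qed.

Lemma socle_sub N : {subset socle N <= N}.
Proof. exact: socle_min. Qed.

Lemma socle_idem N : {subset socle N <= socle (socle N)}.
Proof.
apply: socle_min => P sP PN x xP; apply: (mem_socle sP) => // y yP.
exact: mem_socle yP.
Qed.

End Submodules.

(** An additive map between modules over different rings, which on N carries
    the orbit of each element onto the orbit of its image, has submodules as
    images and preimages of submodules; so it sends a simple submodule of N to
    zero or to a simple submodule, and the socle into the socle.  It is
    applied to multiplication by an idempotent and to both passages between
    a summand and its corner. *)
Section SocleTransfer.
Variables (S S' : pzRingType) (M : lmodType S) (M' : lmodType S').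
Variables (g : {additive M -> M'}) (N : submodClosed M) (N' : submodClosed M').
Hypothesis gN : {in N, forall x, g x \in N'}.
Hypothesis g_scale : {in N, forall x a, exists r, g (a *: x) = r *: g x}.
Hypothesis scale_g : {in N, forall x r, exists a, r *: g x = g (a *: x)}.

Lemma socle_transfer : {in socle N, forall x, g x \in socle N'}.
Proof.
(* The elements that satisfy the conclusion form a submodule, so only simple
   submodules P of N have to be considered. *)
pose Kpred x := x \in N /\ g x \in socle N'.
have Kcl : submod_closed (fun x => `[< Kpred x >]).
  split=> [|a x y /asboolP[xN xK] /asboolP[yN yK]]; apply/asboolP.
    by split; rewrite ?raddf0 rpred0.
  have [r gax] := g_scale xN a.
  by split; rewrite ?rpredD ?rpredZ // raddfD gax rpredD ?rpredZ.
suff sK : {subset socle N <= submod_of Kcl} by move=> x /sK/submod_ofP[].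
apply: socle_min => P sP PN x xP; apply/submod_ofP; split; first exact: PN.
pose gP y := exists2 z, z \in P & y = g z.
have gPcl : submod_closed (fun y => `[< gP y >]).
  split=> [|r y1 y2 /asboolP[z1 z1P ->] /asboolP[z2 z2P ->]]; apply/asboolP.
    by exists 0; rewrite ?raddf0 ?rpred0.
  have [a ->] := scale_g (PN _ z1P) r.
  by exists (a *: z1 + z2); rewrite ?raddfD // rpredD ?rpredZ.
have [->|gx0] := eqVneq (g x) 0; first exact: rpred0.
have gxP : g x \in submod_of gPcl by apply/submod_ofP; exists x.
apply: mem_socle (gxP); last first.
  by move=> y /submod_ofP[z zP ->]; apply/gN/PN.
split=> [|L LP]; first exact: nonzero_submod gxP gx0.
(* A submodule L of g P is tested on its preimage in the simple module P. *)
pose preL z := z \in P /\ g z \in L.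
have preLcl : submod_closed (fun z => `[< preL z >]).
  split=> [|a y z /asboolP[yP yL] /asboolP[zP zL]]; apply/asboolP.
    by split; rewrite ?raddf0 rpred0.
  have [r gay] := g_scale (PN _ yP) a.
  by split; rewrite ?rpredD ?rpredZ // raddfD gay rpredD ?rpredZ.
have preLP : {subset submod_of preLcl <= P} by move=> z /submod_ofP[].
have [_ /(_ _ preLP) [preL0|PpreL]] := sP; [left|right].
  move=> y yL; have /submod_ofP[z zP yE] := LP _ yL.
  have -> : y = g z by []; rewrite (preL0 z) ?raddf0 //.
  by apply/submod_ofP; split; rewrite -?yE.
by move=> y /submod_ofP[z /PpreL/submod_ofP[_ zL] ->].
Qed.

End SocleTransfer.

(** * Essentiality on idempotent summands *)

(** A nonzero x has some nonzero component x e_i.  Treating the components one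
    at a time, multiply x on the left so that the current one falls into N
    without killing it; components already in N remain there.  At the end all
    components of the multiple, hence their sum, lie in N. *)
Lemma essential_summands (S : pzRingType) (I : finType) (e : I -> S)
    (N : submodClosed S^o) :
  \sum_i e i = 1 -> (forall i, e i * e i = e i) ->
  essential N <->
  forall i (y : S), y * e i = y -> y != 0 ->
    exists r, r * y \in N /\ r * y != 0.
Proof.
move=> e1 ee; split=> [essN i y _ nzy|essN L /not_zero_submod[x [xL nzx]]].
  have yy := cyclic_gen (y : S^o).
  have [z [/asboolP[r ->] zN nzz]] := essN _ (nonzero_submod yy nzy).
  by exists r.
suff [r [nzrx rxN]] : exists r, r * x != 0 /\
    forall i, i \in enum I -> r * x * e i \in N.
  exists (r * x); split=> //; first exact: rpredZ.
  rewrite -[r * x]mulr1 -e1 mulr_sumr rpred_sum // => i _.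
  by rewrite rxN ?mem_enum.
elim: (enum I) => [|i l [r [nzrx rxN]]]; first by exists 1; rewrite mul1r.
have [rxi0|nzrxi] := eqVneq (r * x * e i) 0.
  exists r; split=> // j; rewrite inE => /predU1P[->|/rxN //].
  by rewrite rxi0 rpred0.
have [|t [tN nzt]] := essN i _ _ nzrxi; first by rewrite -(mulrA _ (e i)) ee.
exists (t * r); split=> [|j].
  by apply: contraNneq nzt => trx0; rewrite !mulrA trx0 mul0r.
rewrite inE => /predU1P[->|/rxN jN]; first by rewrite !mulrA in tN *.
by rewrite -!mulrA [r * _]mulrA; exact: (rpredZ t).
Qed.

(** * Corners *)

(** A module M over a ring D, presented as the corner e S f over the corner
    ring e S e.  The abstract D and M let the same argument serve for
    coordinates on either side of the matrix ring; [lift] and [coef] identify D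
    with e S e only as far as its action on M is concerned. *)
Record corner (S : pzRingType) (e f : S) (D : pzRingType) (M : lmodType D) :=
  Corner {
    embed : {additive M -> S^o};
    proj : {additive S^o -> M};
    lift : D -> S;
    coef : S -> D;
    projK : cancel embed proj;
    embedK : forall x, embed (proj x) = e * x * f;
    embedZ : forall a m, embed (a *: m) = lift a * embed m;
    coefK : forall r, lift (coef r) = e * r * e
  }.

(** N is the submodule of off-annihilated elements of the corner, expressed in
    [memN] by their S-multiples remaining in e S; [socle_fixed] is the only
    trace of the Nakayama permutation. *)
Section CornerEssential.
Variables (S : pzRingType) (e f : S) (D : pzRingType) (M : lmodType D).
Variable c : corner e f M.
Hypotheses (ee : e * e = e) (ff : f * f = f).
Variable N : submodClosed M.
Hypothesis memN :
  forall m, m \in N <-> forall r, e * (r * embed c m) = r * embed c m.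
Hypothesis socle_fixed :
  {in socle (cyclic_submod (f : S^o)), forall x : S, e * x = x}.

Lemma embed_cornerE m : e * embed c m * f = embed c m.
Proof. by rewrite -(embedK c) projK. Qed.

Lemma embed_fixr m : embed c m * f = embed c m.
Proof. by rewrite -embed_cornerE -!mulrA ff. Qed.

Lemma embed_fixl m : e * embed c m = embed c m.
Proof. by rewrite -embed_cornerE !mulrA ee. Qed.

Lemma embed_coef r m : embed c (coef c r *: m) = e * r * embed c m.
Proof. by rewrite embedZ coefK -mulrA embed_fixl. Qed.

Lemma embed_inj : injective (embed c).
Proof. exact: can_inj (@projK _ _ _ _ _ c). Qed.

Lemma embed_neq0 m : m != 0 -> embed c m != 0.
Proof. by apply: contraNneq => m0; rewrite -[m](projK c) m0 raddf0. Qed.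

Lemma embed_proj x : e * x = x -> x * f = x -> embed c (proj c x) = x.
Proof. by move=> ex xf; rewrite embedK ex xf. Qed.

Lemma mem_cyclic_idem (x : S) :
  (x : S^o) \in cyclic_submod (f : S^o) <-> x * f = x.
Proof.
split=> [/asboolP[a ->]|<-]; last exact: mem_cyclic_submod.
by rewrite /GRing.scale /= -mulrA ff.
Qed.

Lemma embed_socle :
  {in socle N, forall m, embed c m \in socle (@full_submod _ S^o)}.
Proof.
apply: socle_transfer => // m /memN offm a.
  by exists (lift c a); rewrite embedZ.
by exists (coef c a); rewrite embed_coef -mulrA offm.
Qed.

(** Right multiplication by f is linear and retracts S onto S f. *)
Lemma socle_summand (x : S) : x \in socle (@full_submod _ S^o) ->
  (x * f : S^o) \in socle (cyclic_submod (f : S^o)).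
Proof.
have add : zmod_morphism (fun x : S^o => x * f : S^o).
  by move=> y z; rewrite mulrBl.
pose mulf : {additive S^o -> S^o} :=
  HB.pack (fun x : S^o => x * f : S^o) (GRing.isZmodMorphism.Build _ _ _ add).
move: x; apply: (socle_transfer (g := mulf)) => x _ /=.
- by apply/mem_cyclic_idem; rewrite -mulrA ff.
- by move=> a; exists a; rewrite /GRing.scale /= mulrA.
- by move=> a; exists a; rewrite /GRing.scale /= mulrA.
Qed.

(** By [socle_fixed], elements of the socle of S f lie in the corner together
    with all their multiples, so they are off-annihilated.  Restricting to the
    socle is what makes [proj] compatible with the two actions, whence the
    recourse to the socle of the socle. *)
Lemma proj_socle :
  {in socle (cyclic_submod (f : S^o)), forall x, proj c x \in socle N}.
Proof.
have sfix (x : S) : (x : S^o) \in socle (cyclic_submod (f : S^o)) ->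
    embed c (proj c x) = x.
  move=> xs; apply: embed_proj; first exact: socle_fixed.
  exact/mem_cyclic_idem/socle_sub.
move=> x xs; have := socle_idem xs; move: x {xs}.
apply: socle_transfer => x xs.
- by apply/memN => r; rewrite (sfix _ xs) socle_fixed // (rpredZ r).
- move=> r; exists (coef c r); apply: embed_inj.
  by rewrite embed_coef !sfix ?rpredZ // -mulrA socle_fixed // (rpredZ r).
- move=> a; exists (lift c a); apply: embed_inj.
  by rewrite embedZ !sfix ?rpredZ.
Qed.

(** Forwards, a nonzero multiple r y in the socle of S f equals e r y: this is
    the faithfulness statement, and for y in the corner it exhibits a multiple
    of y by e S e in the corner socle.  Backwards, move y into the corner by
    faithfulness, then into the corner socle by essentiality; an element of
    the corner socle lies in the socle of S. *)
Lemma corner_essential :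
  (forall y : S, y * f = y -> y != 0 ->
     exists r, r * y \in socle (@full_submod _ S^o) /\ r * y != 0) <->
  essential (socle N) /\
  (forall y : S, y * f = y -> y != 0 -> exists r, e * r * y != 0).
Proof.
split=> [ess|[essN faithful] y yf nzy].
  have sfix (y r : S) : y * f = y -> r * y \in socle (@full_submod _ S^o) ->
      (r * y : S^o) \in socle (cyclic_submod (f : S^o)).
    by move=> yf /socle_summand; rewrite -mulrA yf.
  split=> [L /not_zero_submod[m [mL nzm]]|y yf nzy]; last first.
    have [r [rs nzr]] := ess y yf nzy; exists r.
    by rewrite -mulrA socle_fixed // sfix.
  have [r [/(sfix _ _ (embed_fixr m)) rs nzr]] :=
    ess _ (embed_fixr m) (embed_neq0 nzm).
  have rE : embed c (coef c r *: m) = r * embed c m.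
    by rewrite embed_coef -mulrA socle_fixed.
  exists (coef c r *: m); split; first exact: rpredZ.
    by rewrite -[_ *: m](projK c) rE proj_socle.
  by apply: contraNneq nzr => m0; rewrite -rE m0 raddf0.
have [r nzm] := faithful y yf nzy; set m := e * r * y in nzm.
have mE : embed c (proj c m) = m.
  by apply: embed_proj; rewrite /m -!mulrA ?yf // mulrA ee.
have nzpm : proj c m != 0.
  by apply: contraNneq nzm => pm0; rewrite -mE pm0 raddf0.
have pmL := cyclic_gen (proj c m).
have [_ [/asboolP[a ->] aN nza]] := essN _ (nonzero_submod pmL nzpm).
exists (lift c a * (e * r)); rewrite -mulrA -/m -mE -embedZ.
by split; [exact: embed_socle | exact: embed_neq0].
Qed.

End CornerEssential.

(** * The top of a summand *)

(** Modulo J, the summand S e_k retains only its component e_k S e_k: the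
    element y differs from e_k y by the sum of the e_j y, j <> k, and
    e_j y = (e_j a e_k) e_k if y = a e_k.  So e_k acts as the identity on
    top(S e_k), and on any module isomorphic to it. *)
Lemma iso_top_fixed (S : pzRingType) (I : finType) (e : I -> S) (J : {pred S})
    (k : I) (N : submodClosed S^o) :
  \sum_i e i = 1 -> (forall i, e i * e i = e i) ->
  (forall j r, j != k -> e j * r * e k \in J) ->
  lmod_iso (sub_lmod N)
    (quot_lmod (ideal_smul (M := sub_lmod (cyclic_submod (e k : S^o))) J)) ->
  {in N, forall x : S, e k * x = x}.
Proof.
move=> e1 ee offJ [f /bij_inj f_inj] x xN.
set P := sub_lmod (cyclic_submod _) in f f_inj.
set Q := quot_lmod _ in f f_inj.
have top_fixed (u : Q) : e k *: u = u.
  rewrite -[u]reprK; move: (repr u) => y; rewrite -[LHS]pi_quot_scale.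
  apply/eqP; rewrite eq_sym -Quotient.idealrBE.
  rewrite -[y in y - _]scale1r -e1 scaler_suml (bigD1 k) //= addrC addrK.
  apply/asboolP => L JL; apply: rpred_sum => j jk.
  (* e_j y must be a multiple by J of an element of S e_k, not merely of S:
     the generator g = e_k serves. *)
  pose g : P := SubLmod (cyclic_gen (e k : S^o)).
  have /asboolP[a yE] := sub_valP y.
  have -> : e j *: y = (e j * a * e k) *: g; last by apply: JL; apply: offJ.
  by apply: val_inj; rewrite !linearZ /= yE /GRing.scale /= -!mulrA ee.
pose y : sub_lmod N := SubLmod xN.
have : e k *: y = y by apply: f_inj; rewrite linearZ; exact: top_fixed.
by move/(congr1 val); rewrite linearZ.
Qed.

(** * Idempotents: isomorphic summands, and local rings *)

(** Right multiplications by u and by v are mutually inverse. *)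
Lemma cyclic_iso (S : pzRingType) (e f u v : S) :
  e * e = e -> f * f = f -> u * f = u -> v * e = v -> u * v = e -> v * u = f ->
  lmod_iso (sub_lmod (cyclic_submod (e : S^o)))
           (sub_lmod (cyclic_submod (f : S^o))).
Proof.
move=> ee ff uf ve uv vu.
have memM g h w (wh : w * h = w) (y : sub_lmod (cyclic_submod (g : S^o))) :
    (sub_val y * w : S^o) \in cyclic_submod (h : S^o).
  apply/asboolP; exists (sub_val y * w : S).
  by rewrite /GRing.scale /= -mulrA wh.
pose mulr_to g h w wh y := SubLmod (@memM g h w wh y).
have lin g h w wh : linear (@mulr_to g h w wh).
  by move=> a y z; apply: val_inj; rewrite /= mulrDl /GRing.scale /= mulrA.
pose phi : {linear _ -> _} := HB.pack (mulr_to e f u uf)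
  (GRing.isLinear.Build S _ _ *:%R (mulr_to e f u uf) (lin e f u uf)).
exists phi, (mulr_to f e v ve) => y; apply: val_inj => /=.
  by have /asboolP[a ->] := sub_valP y; rewrite /GRing.scale /= -!mulrA uv ee.
by have /asboolP[a ->] := sub_valP y; rewrite /GRing.scale /= -!mulrA vu ff.
Qed.

(** One of u and 1 - u is a unit, and their product is zero. *)
Lemma local_idem (D : pzRingType) (u : D) :
  local_ring D -> u * u = u -> u != 0 -> u = 1.
Proof.
move=> [_ nonunitD] uu nzu; have [[v [_ vu]]|nu] := pselect (is_unit u).
  by rewrite -vu -{2}uu mulrA vu mul1r.
have [[v [uv _]]|n1u] := pselect (is_unit (1 - u)).
  by rewrite -[u]mulr1 -uv mulrA mulrBr mulr1 uu subrr mul0r eqxx in nzu.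
by case: (nonunitD _ _ nu n1u); exists 1; rewrite addrC subrK mulr1.
Qed.

(** * Matrix units *)

Section MatrixUnits.
Variables (n : nat) (A : fmdata n).
Implicit Types (i j k l : 'I_n) (x y : fmring A).

(** The matrix with a at position (i,j): since the type of the entries depends
    on the position, the Kronecker symbols carry out the transport of a to the
    entry (k,l), instead of casts along i = k and j = l. *)
Definition mxunit i j (a : A i j) : fmring A :=
  fm_mk (fun k l => fm_mul (fm_mul (fm_delta A k i) a) (fm_delta A j l)).

Lemma entryD x y i j : fm_entry (x + y) i j = fm_entry x i j + fm_entry y i j.
Proof. by rewrite fm_mkE. Qed.

Lemma entry0 i j : fm_entry (0 : fmring A) i j = 0.
Proof. by rewrite fm_mkE. Qed.

Lemma entryM x y i k :
  fm_entry (x * y) i k = \sum_j fm_mul (fm_entry x i j) (fm_entry y j k).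
Proof. by rewrite fm_mkE. Qed.

Lemma mxunitE i j (a : A i j) : fm_entry (mxunit a) i j = a.
Proof. by rewrite fm_mkE !fm_deltaii fm_mul1l fm_mul1r. Qed.

Lemma mxunit_zmod_morphism i j : zmod_morphism (@mxunit i j).
Proof.
move=> a b; apply/eqP; rewrite eq_sym subr_eq; apply/eqP/fm_eqP => k l.
by rewrite entryD !fm_mkE -fm_mulDl -fm_mulDr subrK.
Qed.

Lemma entry_zmod_morphism i j : zmod_morphism (fun x => fm_entry x i j).
Proof.
by move=> x y; apply/eqP; rewrite eq_sym subr_eq -entryD subrK.
Qed.

Lemma entry_mul_mxunit x i j (a : A i j) k l : fm_entry (x * mxunit a) k l =
  fm_mul (fm_mul (fm_entry x k i) a) (fm_delta A j l).
Proof.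
rewrite entryM (bigD1 i) //= big1 => [|m mi]; rewrite fm_mkE.
  by rewrite fm_deltaii fm_mul1l addr0 fm_mulA.
by rewrite fm_delta_neq // !fm_mul0l fm_mul0r.
Qed.

Lemma entry_mxunit_mul i j (a : A i j) x k l : fm_entry (mxunit a * x) k l =
  fm_mul (fm_delta A k i) (fm_mul a (fm_entry x j l)).
Proof.
rewrite entryM (bigD1 j) //= big1 => [|m mj]; rewrite fm_mkE.
  by rewrite fm_deltaii fm_mul1r addr0 fm_mulA.
by rewrite (@fm_delta_neq _ _ j m) 1?eq_sym // fm_mul0r fm_mul0l.
Qed.

Lemma mxunitM i j k (a : A i j) (b : A j k) :
  mxunit a * mxunit b = mxunit (fm_mul a b).
Proof.
apply/fm_eqP => p q; rewrite entry_mul_mxunit !fm_mkE.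
by rewrite fm_deltaii fm_mul1r !fm_mulA.
Qed.

Lemma idemE i : fm_idem A i = mxunit (fm_one A i).
Proof.
apply/fm_eqP => k l; rewrite !fm_mkE fm_mul1r; case: eqVneq => [->|ki].
  by rewrite fm_deltaii fm_mul1l.
by rewrite fm_delta_neq // fm_mul0l.
Qed.

Lemma idem_idem i : fm_idem A i * fm_idem A i = fm_idem A i.
Proof. by rewrite idemE mxunitM fm_mul1l. Qed.

Lemma sum_idem : \sum_i fm_idem A i = 1.
Proof.
apply/fm_eqP => k l.
have -> : fm_entry (\sum_i fm_idem A i) k l =
          \sum_i fm_entry (fm_idem A i) k l.
  by apply: (big_morph (fun x => fm_entry x k l)) => [x y|];
     rewrite ?entryD ?entry0.
rewrite (bigD1 k) //= big1 => [|i ik]; rewrite !fm_mkE ?eqxx ?addr0 //.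
by rewrite eq_sym (negPf ik).
Qed.

Lemma idem_mul_idem i j x :
  fm_idem A i * x * fm_idem A j = mxunit (fm_entry x i j).
Proof.
apply/fm_eqP => k l; rewrite !idemE entry_mul_mxunit entry_mxunit_mul.
by rewrite fm_mkE fm_mul1r fm_mul1l.
Qed.

Lemma idem_mxunit i j (a : A i j) : fm_idem A i * mxunit a = mxunit a.
Proof. by rewrite idemE mxunitM fm_mul1l. Qed.

Lemma mxunit_idem i j (a : A i j) : mxunit a * fm_idem A j = mxunit a.
Proof. by rewrite idemE mxunitM fm_mul1r. Qed.

Lemma mxunit_neq0 i j (a : A i j) : a != 0 -> mxunit a != 0.
Proof. by apply: contraNneq => a0; rewrite -(mxunitE a) a0 entry0. Qed.

Lemma mxunit0 i j : mxunit (0 : A i j) = 0.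
Proof. by apply/fm_eqP => k l; rewrite !fm_mkE fm_mul0r fm_mul0l. Qed.

Lemma entry_neq0 x : x != 0 -> exists i j, fm_entry x i j != 0.
Proof.
move=> nzx; apply: contrapT => no; case/eqP: nzx; apply/fm_eqP => i j.
by rewrite entry0; apply: contrapT => /eqP nzij; apply: no; exists i, j.
Qed.

Hypothesis hlocal : forall i, local_ring (diag_ring A i).
Hypothesis hbasic : fm_basic A.

(** If w is the inverse of b a, then a w b is idempotent, and nonzero because
    b (a w b) (a w) = 1; being in a local ring, it is 1.  Then left
    multiplications by a and by w b are inverse isomorphisms between e_j R and
    e_k R, which are not isomorphic. *)
Lemma offdiag_nonunit j k (b : A j k) (a : A k j) :
  j != k -> ~ is_unit (fm_mul b a : diag_ring A j).
Proof.
move=> jk [w [baw wba]]; case: (hbasic jk).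
have {}baw : fm_mul b (fm_mul a (w : A j j)) = fm_one A j.
  by rewrite -fm_mulA.
have {}wba : fm_mul (w : A j j) (fm_mul b a) = fm_one A j := wba.
have awb : fm_mul a (fm_mul (w : A j j) b) = fm_one A k.
  apply: (@local_idem (diag_ring A k)) => //.
    rewrite -[LHS]/(fm_mul _ _) !fm_mulA -(fm_mulA a w b).
    rewrite -(fm_mulA b (fm_mul a w)).
    by rewrite baw fm_mul1l fm_mulA.
  apply/eqP => awb0; have [nz1 _] := hlocal j; apply: nz1.
  rewrite -[LHS]/(fm_one A j) -[LHS]fm_mul1l -{1}baw -[in X in fm_mul _ X]baw.
  have -> : fm_mul (fm_mul b (fm_mul a w)) (fm_mul b (fm_mul a w)) =
            fm_mul b (fm_mul (fm_mul a (fm_mul w b)) (fm_mul a w)).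
    by rewrite !fm_mulA.
  by rewrite awb0 fm_mul0l fm_mul0r.
rewrite /eR; apply: (@cyclic_iso (fmring A)^c _ _
  (mxunit a) (mxunit (fm_mul (w : A j j) b))).
- exact: idem_idem.
- exact: idem_idem.
- exact: idem_mxunit.
- exact: idem_mxunit.
- by rewrite [LHS]mxunitM fm_mulA idemE; congr mxunit.
- by rewrite [LHS]mxunitM awb idemE.
Qed.

(** Let a be at position (j,k) and L be a maximal left ideal without a.  Then
    1 = z + r a with z in L.  The (k,k) entry d of r a is not a unit, so 1 - d
    has an inverse v at (k,k); as r a lives in column k, v z = e_k.  Hence L
    contains e_k and so a = a e_k, a contradiction. *)
Lemma offdiag_jacobson j k r : j != k ->
  fm_idem A j * r * fm_idem A k \in jacobson (fmring A).
Proof.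
rewrite idem_mul_idem; move: (fm_entry r j k) => {r} a jk.
apply/asboolP => L [_ maxL]; apply: contrapT => aL.
pose Q (y : (fmring A)^o) := exists2 z : (fmring A)^o, z \in L &
    exists r : fmring A, y = (z : fmring A) + r * mxunit a.
have Qcl : submod_closed (fun y : (fmring A)^o => `[< Q y >]).
  split=> [|t _ _ /asboolP[z zL [r ->]] /asboolP[z' zL' [r' ->]]].
    by apply/asboolP; exists 0; [exact: rpred0 | exists 0; rewrite mul0r addr0].
  apply/asboolP; exists (t *: z + z'); first by rewrite rpredD ?rpredZ.
  by exists (t * r + r'); rewrite scalerDr mulrDl -mulrA addrACA.
have LQ : {subset L <= submod_of Qcl}.
  move=> z zL; apply/submod_ofP; exists z => //.
  by exists 0; rewrite mul0r addr0.
have [QL|Qall] := maxL _ LQ.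
  apply/aL/QL/submod_ofP; exists 0; first exact: rpred0.
  by exists 1; rewrite mul1r add0r.
have /submod_ofP[z zL [r one]] := Qall (1 : fmring A).
pose d : diag_ring A k := fm_mul (fm_entry r k j) a.
have [_ nonunitD] := hlocal k.
have [v vd] : exists v : diag_ring A k, v * (1 - d) = 1.
  have [[v [_ vd]]|nd] := pselect (is_unit (1 - d)); first by exists v.
  case: (nonunitD d (1 - d)) => //.
    by apply: offdiag_nonunit; rewrite eq_sym.
  by rewrite addrC subrK; exists 1; rewrite mulr1.
have zE : z = 1 - r * mxunit a by rewrite one addrK.
have ekL : (fm_idem A k : (fmring A)^o) \in L.
  have -> : fm_idem A k = mxunit (v : A k k) * z.
    have -> : mxunit (v : A k k) * z = mxunit (v : A k k) * fm_idem A k -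
        mxunit (v : A k k) * (fm_idem A k * (r * mxunit a) * fm_idem A k).
      rewrite zE mulrBr mulr1 mxunit_idem -[_ * _ * fm_idem A k]mulrA.
      by rewrite -(mulrA r) mxunit_idem (mulrA _ (fm_idem A k)) mxunit_idem.
    rewrite -mulrBr idem_mul_idem entry_mul_mxunit fm_deltaii fm_mul1r idemE.
    by rewrite -mxunit_zmod_morphism mxunitM; congr mxunit; exact: (esym vd).
  exact: (rpredZ (mxunit (v : A k k))).
apply: aL; rewrite -mxunit_idem; exact: (rpredZ (mxunit a)).
Qed.

End MatrixUnits.

(** * Coordinate bimodules as corners *)

Section FormalCorners.
Variables (n : nat) (A : fmdata n).
Implicit Types (i j k l : 'I_n) (x y : fmring A).

(** In the opposite ring the factors are reversed: B_{i,k} = e_i R e_k is the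
    corner whose left idempotent is e_k. *)
Definition rcorner i k : @corner (fmring A)^c (fm_idem A k) (fm_idem A i)
  (diag_ring A k)^c (rcoord A i k).
Proof.
pose emb : {additive rcoord A i k -> (fmring A)^c^o} :=
  HB.pack (@mxunit n A i k : rcoord A i k -> (fmring A)^c^o)
    (GRing.isZmodMorphism.Build (rcoord A i k) (fmring A)^c^o _
       (@mxunit_zmod_morphism n A i k)).
pose prj : {additive (fmring A)^c^o -> rcoord A i k} :=
  HB.pack (fun x : (fmring A)^c^o => fm_entry x i k : rcoord A i k)
    (GRing.isZmodMorphism.Build (fmring A)^c^o (rcoord A i k) _
       (@entry_zmod_morphism n A i k)).
apply: (@Corner _ _ _ _ _ emb prj
  (fun a : A k k => mxunit a) (fun x => fm_entry x k k)).
- by move=> m; rewrite /= mxunitE.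
- by move=> x; rewrite /= -idem_mul_idem -mulrA.
- by move=> a m; rewrite [RHS]mxunitM.
- by move=> x; rewrite -idem_mul_idem -mulrA.
Defined.

Definition lcorner i k : @corner (fmring A) (fm_idem A i) (fm_idem A k)
  (diag_ring A i) (lcoord A i k).
Proof.
pose emb : {additive lcoord A i k -> (fmring A)^o} :=
  HB.pack (@mxunit n A i k : lcoord A i k -> (fmring A)^o)
    (GRing.isZmodMorphism.Build (lcoord A i k) (fmring A)^o _
       (@mxunit_zmod_morphism n A i k)).
pose prj : {additive (fmring A)^o -> lcoord A i k} :=
  HB.pack (fun x : (fmring A)^o => fm_entry x i k : lcoord A i k)
    (GRing.isZmodMorphism.Build (fmring A)^o (lcoord A i k) _
       (@entry_zmod_morphism n A i k)).
apply: (@Corner _ _ _ _ _ emb prj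
  (fun a : A i i => mxunit a) (fun x => fm_entry x i i)).
- by move=> m; rewrite /= mxunitE.
- by move=> x; rewrite /= -idem_mul_idem.
- by move=> a m; rewrite [RHS]mxunitM.
- by move=> x; rewrite -idem_mul_idem.
Defined.

Lemma mem_rann_off i k (m : rcoord A i k) :
  m \in @rann_off n A i k <->
  forall x, mxunit (m : A i k) * x * fm_idem A k = mxunit (m : A i k) * x.
Proof.
split=> [/asboolP off x|fix_ek].
  apply/fm_eqP => p q.
  rewrite idemE entry_mul_mxunit !entry_mxunit_mul fm_mul1r.
  have [<-|kq] := eqVneq k q; first by rewrite fm_deltaii fm_mul1r.
  have /zero_mulB-> : zero_set (mulB (m : A i k) (k := q)).
    by apply: off; rewrite eq_sym.
  by rewrite (@fm_delta_neq _ _ k q) // !fm_mul0r.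
apply/asboolP => l lk; apply/zero_mulB => b.
have := fix_ek (mxunit b); rewrite mxunitM.
move=> /(congr1 (fun x => fm_entry x i l)).
by rewrite mxunitE idemE entry_mul_mxunit fm_delta_neq 1?eq_sym // fm_mul0r.
Qed.

Lemma mem_lann_off i k (m : lcoord A i k) :
  m \in @lann_off n A i k <->
  forall x, fm_idem A i * (x * mxunit (m : A i k)) = x * mxunit (m : A i k).
Proof.
split=> [/asboolP off x|fix_ei].
  apply/fm_eqP => p q.
  rewrite idemE entry_mxunit_mul !entry_mul_mxunit fm_mul1l.
  have [->|pi] := eqVneq p i; first by rewrite fm_deltaii fm_mul1l.
  have /zero_Bmul-> := off p pi.
  by rewrite (@fm_delta_neq _ _ p i) // !fm_mul0l.
apply/asboolP => h hi; apply/zero_Bmul => b.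
have := fix_ei (mxunit b); rewrite mxunitM.
move=> /(congr1 (fun x => fm_entry x h k)).
by rewrite mxunitE idemE entry_mxunit_mul fm_delta_neq // fm_mul0l.
Qed.

(** Conditions (b) and (b') concern entries outside the corner; entries inside
    it pass the test with multiplier 1, which gives the uniform faithfulness
    condition of [corner_essential]. *)
Lemma rfaithful_entries i k :
  (forall x, fm_idem A i * x = x -> x != 0 ->
     exists y, x * y * fm_idem A k != 0) <->
  (forall j (m : A i j), j != k -> m != 0 -> ~ zero_set (mulB m (k := k))).
Proof.
split=> [faithful j m jk nzm /zero_mulB m0|faithful x eix nzx].
  have [y] := faithful _ (idem_mxunit m) (mxunit_neq0 nzm).
  rewrite -[mxunit m](idem_mxunit m) -(mulrA (fm_idem A i)) idem_mul_idem.
  rewrite entry_mxunit_mul m0 fm_mul0r; by rewrite mxunit0 eqxx.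
have [p [j nzpj]] := entry_neq0 nzx.
have pi : p = i.
  apply: contraNeq nzpj => pi; rewrite -eix idemE entry_mxunit_mul.
  by rewrite fm_delta_neq // fm_mul0l.
rewrite {p}pi in nzpj.
suff [b nzb] : exists b : A j k, fm_mul (fm_entry x i j) b != 0.
  exists (mxunit b); rewrite -{1}eix -(mulrA _ x) idem_mul_idem mxunit_neq0 //.
  by rewrite entry_mul_mxunit fm_deltaii fm_mul1r.
have [jk|jk] := eqVneq j k.
  by rewrite -jk; exists (fm_one A j); rewrite fm_mul1r.
apply: contrapT => no; apply: (faithful j _ jk nzpj); apply/zero_mulB => b.
by apply: contrapT => /eqP nzb; apply: no; exists b.
Qed.

Lemma lfaithful_entries i k :
  (forall x, x * fm_idem A k = x -> x != 0 ->
     exists y, fm_idem A i * y * x != 0) <->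
  (forall j (m : A j k), j != i -> m != 0 -> ~ zero_set (Bmul (h := i) m)).
Proof.
split=> [faithful j m ji nzm /zero_Bmul m0|faithful x xek nzx].
  have [y] := faithful _ (mxunit_idem m) (mxunit_neq0 nzm).
  rewrite -[mxunit m](mxunit_idem m) mulrA -(mulrA (fm_idem A i)) idem_mul_idem.
  rewrite entry_mul_mxunit m0 fm_mul0l; by rewrite mxunit0 eqxx.
have [j [q nzjq]] := entry_neq0 nzx.
have qk : q = k.
  apply: contraNeq nzjq => qk; rewrite -xek idemE entry_mul_mxunit.
  by rewrite fm_delta_neq 1?eq_sym // fm_mul0r.
rewrite {q}qk in nzjq.
suff [b nzb] : exists b : A i j, fm_mul b (fm_entry x j k) != 0.
  exists (mxunit b); rewrite -[in X in _ * X]xek mulrA -(mulrA (fm_idem A i)).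
  rewrite idem_mul_idem mxunit_neq0 //.
  by rewrite entry_mxunit_mul fm_deltaii fm_mul1l.
have [ji|ji] := eqVneq j i.
  by rewrite -ji; exists (fm_one A j); rewrite fm_mul1l.
apply: contrapT => no; apply: (faithful j _ ji nzjq); apply/zero_Bmul => b.
by apply: contrapT => /eqP nzb; apply: no; exists b.
Qed.

End FormalCorners.

Theorem theorem13 (n : nat) (A : fmdata n) (s : 'S_n)
    (hlocal : forall i : 'I_n, local_ring (diag_ring A i))
    (hbasic : fm_basic A)
    (hs : nakayama_perm A s) :
  (essential (rsocle A) <->
     forall i : 'I_n,
       essential (Tr A s i) /\
       (forall (j : 'I_n) (m : A i j), j != s i -> m != 0 ->
          ~ zero_set (mulB m (k := s i)))) /\
  (essential (lsocle A) <->
     forall i : 'I_n,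
       essential (Tl A s i) /\
       (forall (j : 'I_n) (m : A j (s i)), j != i -> m != 0 ->
          ~ zero_set (Bmul (h := i) m))).
Proof.
have off j k r := @offdiag_jacobson n A hlocal hbasic j k r.
have roff i j (r : (fmring A)^c) : j != s i ->
    (fm_idem A j : (fmring A)^c) * r * fm_idem A (s i) \in jacobson (fmring A).
  by move=> ji; rewrite -[_ * _ * _]mulrA; apply: off; rewrite eq_sym.
have rfix i := @iso_top_fixed (fmring A)^c _ (fm_idem A) (jacobson (fmring A))
  (s i) _ (sum_idem A) (@idem_idem n A) (roff i) (hs i).1.
have lfix i := @iso_top_fixed (fmring A) _ (fm_idem A) (jacobson (fmring A))
  i _ (sum_idem A) (@idem_idem n A) (fun j r => @off j i r) (hs i).2.
have rcrit i := corner_essential (c := rcorner A i (s i)) (idem_idem A (s i))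
  (idem_idem A i) (@mem_rann_off n A i (s i)) (rfix i).
have lcrit i := corner_essential (c := lcorner A i (s i)) (idem_idem A i)
  (idem_idem A (s i)) (@mem_lann_off n A i (s i)) (lfix i).
split.
  rewrite (@essential_summands (fmring A)^c _ (fm_idem A) (rsocle A)
     (sum_idem A) (@idem_idem n A)).
  split=> crit i; first have /rcrit[essT faithful] := crit i.
    split=> //; apply/rfaithful_entries => y yf nzy.
    by have [r nzr] := faithful y yf nzy; exists r; rewrite -mulrA.
  apply/rcrit; have [essT /rfaithful_entries faithful] := crit i.
  split=> // y yf nzy; have [r nzr] := faithful y yf nzy; exists r.
  by rewrite -mulrA in nzr.
rewrite (@essential_summands (fmring A) _ (fm_idem A) (lsocle A)
     (sum_idem A) (@idem_idem n A)).
split=> crit i; first have /lcrit[essT faithful] := crit (s i).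
  by split=> //; apply/lfaithful_entries.
(* At index i the left-hand conditions describe the summand R e_(s i). *)
rewrite -(permKV s i); apply/lcrit.
by have [essT /lfaithful_entries faithful] := crit (s^-1 i)%g.
Qed.
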